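(* Let $f$ be a real-valued measurable function defined on $[0,1)$ and extended periodically to $\mathbb{R}$ by $f(x+1)=f(x)$, such that for some constants $h$ and $\alpha>0$ $$|f(x)-f(y)|\le h|x-y|^\alpha\ \ (x\ne y),\qquad \int_0^1 f(x)\,dx=0,\qquad \int_0^1 f^2(x)\,dx=1.$$ Let $(m_k)_{k\in\mathbb{N}}$ be an increasing sequence of (positive) integers such that $b_k:=\frac{m_{k+1}}{m_k}\in\{2,3,\dots\}$ for all $k$ and $b_k\to\infty$ as $k\to\infty$. Let $(a_{k,n})_{1\le k\le n}$ be a triangular array of real numbers such that, as $n\to\infty$, $$A_n:=\Big(\sum_{k=1}^n a_{k,n}^2\Big)^{1/2}\to\infty,\qquad \sum_{k=1}^n|a_{k,n}|^3\to 0,\qquad A_n\sum_{k=1}^n\frac{|a_{k,n}|}{b_k^\alpha}\to 0 .$$ Let $S_n^{\mathrm H}(x)=\sum_{k=1}^n a_{k,n}f(m_kx)$. Then $(S_n^{\mathrm H})_{n\in\mathbb{N}}$, regarded as random variables on $[0,1]$ with Lebesgue measure, converges mod-Gaussian in the weak sense (defined in the context) with the sequence $(A_n)$.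
   Context: Weak mod-Gaussian convergence: let $(X_n)$ be real-valued random variables and write $\varphi_n(i\lambda)=\mathbb{E}[e^{i\lambda X_n}]$ for $\lambda\in\mathbb{R}$. One says that $(X_n)$ converges mod-Gaussian in the weak sense, with a sequence $A_n\to\infty$, if: (1) for every $\lambda\in\mathbb{R}$, $\varphi_n\big(\tfrac{i\lambda}{A_n}\big)\to e^{-\lambda^2/2}$ as $n\to\infty$; (2) for every $K\ge 0$, the sequence of functions $\lambda\mapsto\varphi_n\big(\tfrac{i\lambda}{A_n}\big)\mathbf 1_{\{|\lambda|\le A_nK\}}$ is uniformly integrable on $\mathbb{R}$ with respect to Lebesgue measure (for these functions, which are bounded by $1$, this means $\lim_{a\to\infty}\sup_n\int_{|\lambda|\ge a}\big|\varphi_n(\tfrac{i\lambda}{A_n})\big|\mathbf 1_{\{|\lambda|\le A_nK\}}\,d\lambda=0$). *)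

(* Defs.v *)
From HB Require Import structures.
From mathcomp Require Import all_boot all_order all_algebra.
From mathcomp Require Import complex.
From mathcomp Require Import all_classical all_reals all_analysis.
From mathcomp Require Import measurable_realfun.

Set Implicit Arguments.
Unset Strict Implicit.
Unset Printing Implicit Defensive.

Import Order.TTheory GRing.Theory Num.Theory.
Import numFieldNormedType.Exports.
Import ComplexField.Normc.

Local Open Scope classical_set_scope.
Local Open Scope ring_scope.
Local Open Scope complex_scope.

(* The standard (norm) topology of the complex field [R[i]]. *)
HB.instance Definition _ (K : rcfType) :=
  NormedModule.copy (complex K) ((complex K : numClosedFieldType)^o).

Section mod_gaussian.
Context d (T : measurableType d) (R : realType) (P : probability T R).

(* [E[exp(i t X)] = E[cos(t X)] + i E[sin(t X)]]; both integrands are bounded,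
   so [fine] is applied to finite values only. *)
Definition char_fun (X : {RV P >-> R}) (t : R) : R[i] :=
  fine 'E_P[fun w => cos (t * X w)] +i* fine 'E_P[fun w => sin (t * X w)].

(* For uniformly bounded functions on the line, uniform integrability with
   respect to Lebesgue measure amounts to uniformly vanishing tails. *)
Definition bounded_unif_integrable (g : nat -> R -> R[i]) : Prop :=
  (fun c : R => ereal_sup
     [set (\int[lebesgue_measure]_(x in [set y : R | (c <= `|y|)%R])
             (normc (g n x))%:E)%E | n in [set: nat]]) @ +oo%R --> 0%E.

(* Division by [A n] is total: should some [A n] be 0, then
   [t / A n = 0]; as [A n] tends to infinity, this affects finitely many [n]. *)
Definition mod_gaussian_weak (X : nat -> {RV P >-> R}) (A : nat -> R) : Prop :=
  [/\ A n @[n --> \oo] --> +oo,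
      forall t : R, char_fun (X n) (t / A n) @[n --> \oo]
                      --> (expR (- (t ^+ 2) / 2))%:C
    & forall K : R, 0 <= K ->
        bounded_unif_integrable (fun n t =>
          char_fun (X n) (t / A n) * (\1_[set s | `|s| <= A n * K] t)%:C)].

End mod_gaussian.

Section unit_interval.
Variable R : realType.

Definition lebesgue01 : set (measurableTypeR R) -> \bar R :=
  mrestr (@lebesgue_measure R) (measurable_itv `[0, 1]).

HB.instance Definition _ := Measure.on lebesgue01.

Let lebesgue01_setT : lebesgue01 setT = 1%E.
Proof.
rewrite /lebesgue01 /mrestr setTI lebesgue_measure_itv /=.
by rewrite lte_fin ltr01 oppr0 adde0.
Qed.

HB.instance Definition _ :=
  Measure_isProbability.Build _ _ _ lebesgue01 lebesgue01_setT.

End unit_interval.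

Section lacunary.
Variable R : realType.

(* The sequences [m] and [b] are indexed by k = 1, 2, ...; the array entry
   a_{k,n} is [a k n] for 1 <= k <= n.  Other values play no role, and the
   index n = 0 gives empty sums. *)

Definition gap_ratio (m : nat -> nat) (k : nat) : nat := m k.+1 %/ m k.

Definition array_norm (a : nat -> nat -> R) (n : nat) : R :=
  Num.sqrt (\sum_(1 <= k < n.+1) a k n ^+ 2).

Definition lacunary_sum (f : R -> R) (m : nat -> nat) (a : nat -> nat -> R)
    (n : nat) (x : measurableTypeR R) : R :=
  \sum_(1 <= k < n.+1) a k n * f ((m k)%:R * x).

Lemma measurable_lacunary_sum (f : {mfun R >-> R}) m a n :
  measurable_fun [set: measurableTypeR R] (lacunary_sum f m a n).
Proof.
apply: measurable_sum => k; apply: measurable_funM => //.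
by apply: measurableT_comp => //; exact: measurable_funM.
Qed.

HB.instance Definition _ (f : {mfun R >-> R}) m a n :=
  isMeasurableFun.Build _ _ (measurableTypeR R) R (lacunary_sum f m a n)
    (measurable_lacunary_sum f m a n).

Definition lacunary_RV (f : {mfun R >-> R}) (m : nat -> nat)
    (a : nat -> nat -> R) (n : nat) : {RV @lebesgue01 R >-> R} :=
  lacunary_sum f m a n.

End lacunary.

(* Main.v *)
Require Import Defs.
From mathcomp Require Import all_boot all_order all_algebra.
From mathcomp Require Import all_classical all_reals all_analysis.
From mathcomp Require Import measurable_realfun complex ring lra.

Import Order.TTheory GRing.Theory Num.Theory.
Import numFieldNormedType.Exports.
Import ComplexField.Normc.

Local Open Scope classical_set_scope.
Local Open Scope ring_scope.

(** Why the theorem holds. Write b_k = m_(k+1) / m_k and sample f at the left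
    ends of b_k equal cells of [0, 1), centered to have mean zero: this is
    [centered_sample], c_k(d) for 0 <= d < b_k. Because b_k is an integer, the
    cells of length 1 / m_(k+1) are mapped by x |-> m_k x inside unit
    intervals with integer ends, so the Hoelder bound on [0, 1) alone gives
    |f(m_k x) - c_k(d)| <= 2 h / b_k^alpha, where d is the k-th digit of x in
    the mixed radix system with bases b_k ([near_digit], [centered_sampleP]).
    Under the uniform distribution the digits are independent, which on the
    finite grid of mesh 1 / m_(n+1) is a pure counting identity
    ([mean_prod_digits]). Hence the characteristic function of S_n at t differs
    by at most 4 h |t| S, where S is the sum over k of |a_k| / b_k^alpha, from a
    product of characteristic functions of discrete centered variables
    ([char_fun_lacunary_near]). The passage from the interval to the grid
    rests on one estimate: the integral of a function which is within delta of
    a step function on equal cells is within delta of the mean of the steps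
    ([integral_near_step]); it serves for f, for f^2, and for the cosine and
    sine of t S_n.

    Each factor equals 1 - s_k u^2 / 2 up to (B |u|)^3, with u = t a_k, s_k the
    variance of c_k, and B a bound for |c_k|; it is therefore close to the
    Gaussian exp(- s_k u^2 / 2), and dominated by that Gaussian times
    exp ((B |u|)^3) ([normc_mean_expi_gauss]). Moreover |s_k - 1| is of order
    1 / b_k^alpha, so that, as soon as all |a_k| <= 1, the sum of the s_k a_k^2
    is within a multiple of S of A_n^2.

    With t = y / A_n these facts give both requirements
    ([lacunary_char_fun_bounds]). For fixed y, the distance to exp(- y^2 / 2) is
    bounded by multiples of A_n S and of the sum of the |a_k|^3, which tend to
    zero. For |y| <= A_n K, the characteristic function is at most a multiple of
    exp(- y^2 / 4), whose tails are uniformly small, plus 4 h K S; integrated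
    over |y| <= A_n K the second term contributes a multiple of A_n S, which
    tends to zero ([bounded_unif_integrable_gauss]).

    The lemmas index the levels by k < n, with m_(k+1) = m_k b_k, so that level k
    there is level k + 1 of the theorem. *)

(** * Trigonometric inequalities *)

Lemma lipschitz_of_derivative (R : realType) (f df : R -> R)
    (df_f : forall x : R, is_derive x 1 f (df x)) (C x y : R)
    (df_le : forall z, Num.min x y <= z <= Num.max x y -> `|df z| <= C) :
  `|f x - f y| <= C * `|x - y|.
Proof.
wlog xy : x y df_le / x <= y => [hw|].
  have [xy|/ltW yx] := leP x y; first exact: hw.
  by rewrite distrC [`|x - y|]distrC; apply: hw => //; rewrite minC maxC.
rewrite distrC [`|x - y|]distrC.
have cf : {within `[x, y], continuous f}.
  by apply: derivable_within_continuous => z _; case: (df_f z).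
have [z] := MVT_segment xy (fun z _ => df_f z) cf.
rewrite in_itv/= => zxy ->.
rewrite normrM ler_wpM2r// df_le//.
by rewrite (min_idPl xy) (max_idPr xy).
Qed.

Lemma cos_lipschitz (R : realType) (x y : R) : `|cos x - cos y| <= `|x - y|.
Proof.
rewrite -[leRHS]mul1r; apply: lipschitz_of_derivative => z _.
by rewrite normrN sin_max.
Qed.

Lemma sin_lipschitz (R : realType) (x y : R) : `|sin x - sin y| <= `|x - y|.
Proof.
rewrite -[leRHS]mul1r; apply: lipschitz_of_derivative => z _.
exact: cos_max.
Qed.

Lemma normr_sin_le (R : realType) (x : R) : `|sin x| <= `|x|.
Proof. by have := sin_lipschitz R x 0; rewrite sin0 !subr0. Qed.

Lemma one_sub_cosE (R : realType) (x : R) : 1 - cos x = 2 * sin (x / 2) ^+ 2.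
Proof.
have {1}-> : x = (x / 2) *+ 2 by rewrite -mulr_natr divfK.
by rewrite cos_mulr2n cos2sin2; ring.
Qed.

(** By the mean value theorem, as the derivative 1 - cos z of z - sin z is
    2 (sin (z / 2))^2 <= z^2 / 2. *)
Lemma sin_taylor (R : realType) (x : R) : `|x - sin x| <= `|x| ^+ 3 / 2.
Proof.
have -> : x - sin x = (x - sin x) - (0 - sin 0) by rewrite sin0 !subr0.
have -> : `|x| ^+ 3 / 2 = `|x| ^+ 2 / 2 * `|x - 0| by rewrite subr0; ring.
apply: (@lipschitz_of_derivative _ (fun x => x - sin x) (fun x => 1 - cos x)).
move=> z zx; rewrite one_sub_cosE.
have z2 : `|z| ^+ 2 <= `|x| ^+ 2.
  rewrite lerXn2r ?nnegrE//; move: zx; rewrite ge_min le_max.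
  case/andP => /orP[h1|h1] /orP[h2|h2];
    by have [x0|x0] := ger0P x; have [z0|z0] := ger0P z; lra.
rewrite ger0_norm; last by apply: mulr_ge0 => //; exact: sqr_ge0.
have := normr_sin_le R (z / 2); rewrite normf_div [`|2|]ger0_norm//.
move=> hs.
have : `|sin (z / 2)| ^+ 2 <= (`|z| / 2) ^+ 2.
  by rewrite lerXn2r// ?nnegrE ?divr_ge0.
rewrite -normrX ger0_norm ?sqr_ge0// expr_div_n => hs2.
by rewrite ler_pdivlMr//; lra.
Qed.

(** With v = x / 2, the difference factors as
    2 (v - sin v) (v + sin v), which reduces the bound to that on the sine. *)
Lemma cos_taylor (R : realType) (x : R) :
  `|cos x - (1 - x ^+ 2 / 2)| <= `|x| ^+ 4 / 8.
Proof.
set v := x / 2.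
have -> : cos x - (1 - x ^+ 2 / 2) = 2 * ((v - sin v) * (v + sin v)).
  have -> : cos x = 1 - 2 * sin v ^+ 2 by rewrite -one_sub_cosE; ring.
  by rewrite /v; field.
rewrite normrM ger0_norm// normrM.
have h1 := sin_taylor R v; have h2 : `|v + sin v| <= 2 * `|v|.
  by rewrite (le_trans (ler_normD _ _))// mulr2n mulrDl mul1r lerD2l normr_sin_le.
rewrite (_ : _ / 8 = 2 * ((`|v| ^+ 3 / 2) * (2 * `|v|))); last first.
  by rewrite normf_div [`|2|]ger0_norm//; field.
by rewrite ler_pM2l// ler_pM.
Qed.

(** * Complex exponentials and their means *)

Local Open Scope complex_scope.

Lemma normc_normr (R : rcfType) (z : R[i]) : `|z| = (normc z)%:C.
Proof. by []. Qed.

Lemma normc_ge0 (R : rcfType) (z : R[i]) : 0 <= normc z.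
Proof. by case: z => x y; exact: sqrtr_ge0. Qed.

Lemma normcD (R : rcfType) (z w : R[i]) : normc (z + w) <= normc z + normc w.
Proof. by rewrite -lecR rmorphD -!normc_normr ler_normD. Qed.

Lemma normcN (R : rcfType) (z : R[i]) : normc (- z) = normc z.
Proof. by case: z => x y /=; rewrite !sqrrN. Qed.

Lemma normcBC (R : rcfType) (z w : R[i]) : normc (z - w) = normc (w - z).
Proof. by rewrite -normcN opprB. Qed.

Lemma normc_real (R : rcfType) (x : R) : normc x%:C = `|x|.
Proof. by rewrite /= expr0n addr0 sqrtr_sqr. Qed.

Lemma normc_le_ReIm (R : rcfType) (x y : R) : normc (x +i* y) <= `|x| + `|y|.
Proof.
rewrite -[leRHS]ger0_norm ?addr_ge0// -[leRHS]sqrtr_sqr /= ler_wsqrtr//.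
rewrite sqrrD !real_normK ?num_real// lerD2r lerDl.
by rewrite mulrn_wge0// mulr_ge0.
Qed.

Lemma normc_sum (R : rcfType) (I : Type) (r : seq I) (P : pred I) (z : I -> R[i]) :
  normc (\sum_(i <- r | P i) z i) <= \sum_(i <- r | P i) normc (z i).
Proof.
elim/big_rec2: _ => [|i y x _ le_xy]; first by rewrite normc0.
by rewrite (le_trans (normcD _ _ _))// lerD2l.
Qed.

Lemma normc_prod (R : rcfType) (I : Type) (r : seq I) (P : pred I) (z : I -> R[i]) :
  normc (\prod_(i <- r | P i) z i) = \prod_(i <- r | P i) normc (z i).
Proof. by apply: big_morph; [exact: normcM|exact: normc1]. Qed.

(** Telescoping: factors are exchanged one at a time, and the other factors
    have modulus at most 1. *)
Lemma normc_sub_prod (R : rcfType) (I : Type) (r : seq I) (z w : I -> R[i])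
    (z_le1 : forall i, normc (z i) <= 1) (w_le1 : forall i, normc (w i) <= 1) :
  normc (\prod_(i <- r) z i - \prod_(i <- r) w i)
    <= \sum_(i <- r) normc (z i - w i).
Proof.
elim: r => [|i r ih]; first by rewrite !big_nil subrr normc0.
rewrite !big_cons.
have -> : z i * \prod_(j <- r) z j - w i * \prod_(j <- r) w j =
    (z i - w i) * \prod_(j <- r) z j
      + w i * (\prod_(j <- r) z j - \prod_(j <- r) w j) by ring.
rewrite (le_trans (normcD _ _ _))// !normcM lerD//.
- rewrite ler_piMr ?normc_ge0// normc_prod.
  by apply: prodr_ile1 => j _; rewrite normc_ge0 z_le1.
- by rewrite (le_trans _ ih)// ler_piMl ?normc_ge0.
Qed.

Definition expi {R : realType} (x : R) : R[i] := cos x +i* sin x.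

Lemma expi0 (R : realType) : expi (0 : R) = 1.
Proof. by rewrite /expi cos0 sin0. Qed.

Lemma expiD (R : realType) (x y : R) : expi (x + y) = expi x * expi y.
Proof.
rewrite /expi cosD sinD addrC [RHS]/GRing.mul/=.
by rewrite [X in _ +i* X]addrC [X in X +i* _]addrC.
Qed.

Lemma expi_sum (R : realType) (I : Type) (r : seq I) (P : pred I) (x : I -> R) :
  expi (\sum_(i <- r | P i) x i) = \prod_(i <- r | P i) expi (x i).
Proof. by apply: big_morph; [exact: expiD|exact: expi0]. Qed.

Lemma normc_expi (R : realType) (x : R) : normc (expi x) = 1.
Proof. by rewrite /= cos2Dsin2 sqrtr1. Qed.

Lemma expi_taylor (R : realType) (x : R) (x_le1 : `|x| <= 1) :
  normc (expi x - ((1 - x ^+ 2 / 2) +i* x)) <= `|x| ^+ 3.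
Proof.
rewrite (le_trans (normc_le_ReIm _ _ _))//=.
have := cos_taylor R x; have := sin_taylor R x; rewrite distrC => hs hc.
have : `|x| ^+ 4 <= `|x| ^+ 3 by rewrite exprS ler_piMl// exprn_ge0.
have : 0 <= `|x| ^+ 3 by rewrite exprn_ge0.
lra.
Qed.

Definition mean {K : fieldType} (b : nat) (F : nat -> K) : K :=
  b%:R^-1 * \sum_(d < b) F d.

Lemma mean_cst (K : numFieldType) (b : nat) (b_gt0 : (0 < b)%N) (c : K) :
  mean b (fun=> c) = c.
Proof.
by rewrite /mean sumr_const card_ord -[c *+ b]mulr_natl mulKf// pnatr_eq0 -lt0n.
Qed.

Lemma meanD (K : fieldType) (b : nat) (F G : nat -> K) :
  mean b (fun d => F d + G d) = mean b F + mean b G.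
Proof. by rewrite /mean big_split mulrDr. Qed.

Lemma meanB (K : fieldType) (b : nat) (F G : nat -> K) :
  mean b (fun d => F d - G d) = mean b F - mean b G.
Proof. by rewrite /mean sumrB mulrBr. Qed.

Lemma meanZ (K : fieldType) (b : nat) (c : K) (F : nat -> K) :
  mean b (fun d => c * F d) = c * mean b F.
Proof. by rewrite /mean -mulr_sumr mulrCA. Qed.

Lemma eq_mean (K : fieldType) (b : nat) (F G : nat -> K)
    (eqFG : forall d, (d < b)%N -> F d = G d) : mean b F = mean b G.
Proof. by rewrite /mean; congr (_ * _); apply: eq_bigr => d _; exact: eqFG. Qed.

Lemma mean_real_complex (R : rcfType) (b : nat) (F : nat -> R) :
  (mean b F)%:C = mean b (fun d => (F d)%:C).
Proof. by rewrite /mean rmorphM fmorphV rmorph_nat rmorph_sum. Qed.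

Lemma mean_complex (R : rcfType) (b : nat) (F G : nat -> R) :
  mean b (fun d => F d +i* G d) = mean b F +i* mean b G.
Proof.
rewrite [RHS]complexE/= !mean_real_complex -meanZ -meanD.
by apply: eq_mean => d _; rewrite [LHS]complexE.
Qed.

Lemma mean_le (R : numFieldType) (b : nat) (F G : nat -> R)
  (leFG : forall d, (d < b)%N -> F d <= G d) : mean b F <= mean b G.
Proof. by rewrite /mean ler_wpM2l// ler_sum// => d _; exact: leFG. Qed.

Lemma normc_mean_le (R : rcfType) (b : nat) (F : nat -> R[i]) :
  normc (mean b F) <= mean b (fun d => normc (F d)).
Proof.
rewrite /mean normcM normcV -[b%:R in leLHS](rmorph_nat (real_complex R)).
by rewrite normc_real normr_nat ler_wpM2l// normc_sum.
Qed.

Lemma normr_mean_le (R : realFieldType) (b : nat) (F : nat -> R) :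
  `|mean b F| <= mean b (fun d => `|F d|).
Proof.
by rewrite /mean normrM normfV normr_nat ler_wpM2l// ler_norm_sum.
Qed.

Lemma normr_mean_bound (R : realFieldType) (b : nat) (b_gt0 : (0 < b)%N)
    (F : nat -> R) (B : R) (F_le : forall d, (d < b)%N -> `|F d| <= B) :
  `|mean b F| <= B.
Proof.
rewrite (le_trans (normr_mean_le _ _ _))// -[leRHS](mean_cst _ _ b_gt0).
exact: mean_le.
Qed.

Lemma normc_mean_expi_le1 (R : realType) (b : nat) (b_gt0 : (0 < b)%N)
  (x : nat -> R) : normc (mean b (fun d => expi (x d))) <= 1.
Proof.
rewrite (le_trans (normc_mean_le _ _ _))// -[leRHS](mean_cst _ _ b_gt0).
by apply: mean_le => d _; rewrite normc_expi.
Qed.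

(** The first order term of the expansion of exp(i u c) averages out because
    c has mean zero. *)
Lemma mean_expi_taylor (R : realType) (b : nat) (b_gt0 : (0 < b)%N)
    (c : nat -> R) (B u : R) (c_mean : mean b c = 0)
    (c_le : forall d, (d < b)%N -> `|c d| <= B) (u_small : B * `|u| <= 1) :
  normc (mean b (fun d => expi (u * c d))
         - (1 - mean b (fun d => c d ^+ 2) * u ^+ 2 / 2)%:C)
    <= (B * `|u|) ^+ 3.
Proof.
have uc_le d : (d < b)%N -> `|u * c d| <= B * `|u|.
  by move=> db; rewrite normrM mulrC ler_wpM2r// c_le.
have -> : (1 - mean b (fun d => c d ^+ 2) * u ^+ 2 / 2)%:C =
    mean b (fun d => (1 - (u * c d) ^+ 2 / 2) +i* (u * c d)).
  rewrite mean_complex meanB mean_cst// meanZ c_mean mulr0.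
  rewrite (_ : mean b (fun d => (u * c d) ^+ 2 / 2) =
    u ^+ 2 / 2 * mean b (fun d => c d ^+ 2)); last first.
    by rewrite -meanZ; apply: eq_mean => d _; rewrite exprMn; ring.
  by rewrite complexr0; congr (_%:C); ring.
rewrite -meanB (le_trans (normc_mean_le _ _ _))// -[leRHS](mean_cst _ _ b_gt0).
apply: mean_le => d db; rewrite (le_trans (expi_taylor _ _ _))//.
  by rewrite (le_trans (uc_le _ db)).
by rewrite lerXn2r ?nnegrE ?uc_le// (le_trans _ (uc_le _ db)).
Qed.

(** Both comparisons of 1 - y, where y = s u^2 / 2, with exp(- y):
    1 - y <= exp(- y) gives the domination, and exp(- y) <= 1 - y + y^2 the
    distance. *)
Lemma normc_mean_expi_gauss (R : realType) (b : nat) (b_gt0 : (0 < b)%N)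
    (c : nat -> R) (B u : R) (c_mean : mean b c = 0)
    (c_le : forall d, (d < b)%N -> `|c d| <= B) (u_small : B * `|u| <= 1) :
  let s := mean b (fun d => c d ^+ 2) in
  normc (mean b (fun d => expi (u * c d))) <=
    expR (- (s * u ^+ 2 / 2) + (B * `|u|) ^+ 3)
  /\ normc (mean b (fun d => expi (u * c d)) - (expR (- (s * u ^+ 2 / 2)))%:C)
    <= 2 * (B * `|u|) ^+ 3.
Proof.
move=> s; have h := mean_expi_taylor R b b_gt0 c B u c_mean c_le u_small.
have B_ge0 : 0 <= B by rewrite (le_trans _ (c_le _ b_gt0)).
have Bu_ge0 : 0 <= B * `|u| by rewrite mulr_ge0.
set y := s * u ^+ 2 / 2; rewrite -/s -/y in h *.
have s_ge0 : 0 <= s.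
  rewrite -(mean_cst R _ b_gt0 0); apply: mean_le => d _; exact: sqr_ge0.
have s_le : s <= B ^+ 2.
  rewrite -[leRHS](mean_cst R _ b_gt0); apply: mean_le => d db.
  by rewrite -real_normK ?num_real// lerXn2r ?nnegrE// c_le.
have y_ge0 : 0 <= y by rewrite divr_ge0// mulr_ge0// sqr_ge0.
have y_le : y <= (B * `|u|) ^+ 2 / 2.
  by rewrite exprMn real_normK ?num_real// ler_wpM2r// ler_wpM2r// sqr_ge0.
have y_le1 : y <= 1.
  have : (B * `|u|) ^+ 2 <= 1 by rewrite exprn_ile1.
  by lra.
split.
  have -> : mean b (fun d => expi (u * c d)) =
    (mean b (fun d => expi (u * c d)) - (1 - y)%:C) + (1 - y)%:C by rewrite subrK.
  rewrite (le_trans (normcD _ _ _))// normc_real ger0_norm ?subr_ge0//.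
  rewrite (le_trans _ (expR_ge1Dx _))//; lra.
(* The remaining error |1 - y - exp(- y)| is at most y^2, and
   y^2 <= (B |u|)^4 / 4 <= (B |u|)^3 since B |u| <= 1. *)
rewrite (_ : _ - _ = (mean b (fun d => expi (u * c d)) - (1 - y)%:C) +
  (1 - y - expR (- y))%:C); last by rewrite rmorphB/=; ring.
rewrite (le_trans (normcD _ _ _))// normc_real mulr2n mulrDl mul1r lerD//.
apply: (@le_trans _ _ (y ^+ 2)).
  rewrite distrC ger0_norm; last by have := expR_ge1Dx (- y); lra.
  rewrite expRN lerBlDr.
  have e1 := expR_ge1Dx y.
  rewrite (@le_trans _ _ (1 + y)^-1)// ?lef_pV2 ?posrE ?expR_gt0//; first lra.
  rewrite -div1r ler_pdivrMr; last lra.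
  have : 0 <= y ^+ 3 by rewrite exprn_ge0.
  by move=> y3; rewrite (_ : _ * _ = 1 + y ^+ 3) ?lerDl//; ring.
apply: (@le_trans _ _ (((B * `|u|) ^+ 2 / 2) ^+ 2)).
  by rewrite ler_pXn2r ?nnegrE ?(le_trans y_ge0 y_le).
set w := B * `|u| in Bu_ge0 u_small *.
have : w ^+ 4 <= w ^+ 3 by rewrite exprS ler_piMl// exprn_ge0.
have : 0 <= w ^+ 3 by rewrite exprn_ge0.
rewrite (_ : (_ / 2) ^+ 2 = w ^+ 4 / 4); last by field.
by move=> ? ?; lra.
Qed.

(** * Mixed radix digits *)

Lemma sum_ord_mul (V : nmodType) (p q : nat) (F : nat -> V) :
  \sum_(j < p * q) F j = \sum_(i < p) \sum_(d < q) F (i * q + d)%N.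
Proof.
rewrite -(big_mkord xpredT F) big_nat_mul big_mkord; apply: eq_bigr => i _.
rewrite mulSn addnC -{1}[(i * q)%N]add0n big_addn addKn big_mkord.
by apply: eq_bigr => d _; rewrite addnC.
Qed.

(** Independence of the digits, in counting form: writing
    j = j' b_n + d, the last digit of j is d, and the previous digits of j are
    the digits of j' at the coarser scale m_n. *)
Lemma sum_prod_digits (K : comNzRingType) (m b : nat -> nat)
    (m_gt0 : forall k, (0 < m k)%N) (mS : forall k, m k.+1 = (m k * b k)%N)
    (G : nat -> nat -> K) (n : nat) :
  \sum_(j < m n) \prod_(k < n) G k ((j %/ (m n %/ m k.+1)) %% b k)%N
  = (m 0)%:R * \prod_(k < n) \sum_(d < b k) G k d.
Proof.
have m_dvd k l : (m k %| m (k + l))%N.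
  by elim: l => [|l ih]; rewrite ?addn0// addnS mS dvdn_mulr.
elim: n => [|n ih].
  under eq_bigr do rewrite big_ord0.
  by rewrite big_ord0 sumr_const card_ord mulr1.
rewrite mS (sum_ord_mul _ _ _ (fun j => \prod_(k < n.+1)
  G k ((j %/ (m n * b n %/ m k.+1)) %% b k)%N)) big_ord_recr/= mulrA -ih mulr_suml.
apply: eq_bigr => j _; rewrite mulr_sumr; apply: eq_bigr => d _.
have b_gt0 : (0 < b n)%N by have := m_gt0 n.+1; rewrite mS muln_gt0 => /andP[].
rewrite big_ord_recr/= mS divnn muln_gt0 m_gt0 b_gt0 divn1 modnMDl modn_small//.
congr (_ * _); apply: eq_bigr => k _; congr (G k (_ %% _)%N).
have /dvdnP[q mnE] : (m k.+1 %| m n)%N.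
  by have := m_dvd k.+1 (n - k.+1)%N; rewrite subnKC.
move: (nat_of_ord j) (ltn_ord d) => i; rewrite mnE => d_lt.
by rewrite mulnAC !mulnK// [(q * _)%N]mulnC divnMA divnMDl//
  [(d %/ _)%N]divn_small// addn0.
Qed.

Lemma mean_prod_digits (K : numFieldType) (m b : nat -> nat)
    (m_gt0 : forall k, (0 < m k)%N) (mS : forall k, m k.+1 = (m k * b k)%N)
    (G : nat -> nat -> K) (n : nat) :
  mean (m n) (fun j => \prod_(k < n) G k ((j %/ (m n %/ m k.+1)) %% b k)%N)
  = \prod_(k < n) mean (b k) (G k).
Proof.
rewrite /mean (sum_prod_digits K m b m_gt0 mS G n) big_split/= mulrA; congr (_ * _).
have m0_neq0 k : (m k)%:R != 0 :> K by rewrite pnatr_eq0 -lt0n.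
elim: n => [|n ih]; first by rewrite big_ord0 mulVf.
rewrite big_ord_recr/= -ih mS natrM invfM mulrAC; congr (_ * _).
Qed.

(** * Integrals of functions close to a step function *)

Lemma normr_Rintegral_sub_cst d (T : measurableType d) (R : realType)
    (mu : {measure set T -> \bar R}) (A : set T) (mA : measurable A)
    (F : T -> R) (F_int : mu.-integrable A (EFin \o F)) (r g delta : R)
    (muA : mu A = r%:E) (F_near : forall x, A x -> `|F x - g| <= delta) :
  `|\int[mu]_(x in A) F x - g * r| <= delta * r.
Proof.
have cst_int c : mu.-integrable A (EFin \o cst c).
  by apply: measurable_bounded_integrable;
    [| rewrite muA ltry | | exact: bounded_cst].
have Fg_int : mu.-integrable A (EFin \o (fun x => F x - g)).
  by have := integrableB mA F_int (cst_int g).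
have E c : \int[mu]_(x in A) (cst c x) = c * r by rewrite Rintegral_cst// muA.
rewrite -(E g) -(E delta) -RintegralB//.
apply: (le_trans (le_normr_Rintegral mA Fg_int)).
by apply: le_Rintegral => //; exact: integrable_norm Fg_int.
Qed.

Lemma Rintegral_near_step (R : realType)
    (mu : {measure set (measurableTypeR R) -> \bar R})
    (mu_itv : forall x y : R, 0 <= x -> x <= y -> y <= 1 ->
      mu `[x, y[%classic = (y - x)%:E)
    (F : measurableTypeR R -> R) (F_int : mu.-integrable `[(0 : R), 1[ (EFin \o F))
    (M : nat) (G : nat -> R) (delta : R)
    (F_near : forall j x, (j < M)%N -> j%:R / M%:R <= x < j.+1%:R / M%:R ->
      `|F x - G j| <= delta) (N : nat) :
  (0 < M)%N -> (N <= M)%N ->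
  `|\int[mu]_(x in `[0, N%:R / M%:R[) F x - M%:R^-1 * \sum_(j < N) G j|
    <= delta * (N%:R / M%:R).
Proof.
move=> M_gt0; have MR : 0 < M%:R :> R by rewrite ltr0n.
elim: N => [_|N ih NM].
  by rewrite mul0r set_itvco0 Rintegral_set0 big_ord0 mulr0 subrr normr0 mulr0.
have N0 : 0 <= N%:R / M%:R :> R by rewrite divr_ge0.
have NN : N%:R / M%:R <= N.+1%:R / M%:R :> R.
  by rewrite ler_pM2r ?invr_gt0// ler_nat.
have N1 : N.+1%:R / M%:R <= 1 :> R by rewrite ler_pdivrMr// mul1r ler_nat.
have U : `[0, N.+1%:R / M%:R[%classic =
    `[0, N%:R / M%:R[%classic `|` `[N%:R / M%:R, N.+1%:R / M%:R[%classic :> set R.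
  by apply: itv_bndbnd_setU; rewrite bnd_simp.
have sub01 x y : 0 <= x -> y <= 1 ->
    mu.-integrable `[x, y[%classic (EFin \o F).
  move=> x0 y1; apply: integrableS F_int => //.
  by apply: subset_itv; rewrite bnd_simp.
rewrite U Rintegral_setU//; last 2 first.
- by rewrite -U; exact: sub01.
- rewrite disj_set2E; apply/eqP/seteqP; split => // x [] /=.
  by rewrite !in_itv/= => /andP[_ ?] /andP[? _]; lra.
have h := ih (ltnW NM).
have NE : N.+1%:R / M%:R - N%:R / M%:R = M%:R^-1 :> R.
  by rewrite -mulrBl -natrB// subSnn mul1r.
have := @normr_Rintegral_sub_cst _ _ _ mu `[N%:R / M%:R, N.+1%:R / M%:R[%classic
  (measurable_itv _) F (sub01 _ _ N0 N1) (M%:R^-1) (G N) delta.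
rewrite mu_itv// NE => /(_ erefl) h2.
have {}h2 := h2 (fun x => F_near N x NM).
rewrite big_ord_recr/= mulrDr [_^-1 * G N]mulrC.
rewrite (_ : _ + _ - _ = (\int[mu]_(x in `[0, N%:R / M%:R[) F x
  - M%:R^-1 * \sum_(j < N) G j)
  + (\int[mu]_(x in `[N%:R / M%:R, N.+1%:R / M%:R[) F x
  - G N * M%:R^-1)); last by ring.
rewrite (le_trans (ler_normD _ _))// (le_trans (lerD h h2))//.
by rewrite -mulrDr -natr1 mulrDl mul1r.
Qed.

(** The domain D may differ from [0, 1) by a null set, and only the measure of
    the intervals [x, y) matters; this covers both Lebesgue measure on the
    closed interval [0, 1] and its restriction as a probability on the line. *)
Lemma integral_near_step (R : realType)
    (mu : {measure set (measurableTypeR R) -> \bar R})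
    (mu_itv : forall x y : R, 0 <= x -> x <= y -> y <= 1 ->
      mu `[x, y[%classic = (y - x)%:E)
    (D : set (measurableTypeR R)) (mD : measurable D)
    (D_sup : `[(0 : R), 1[%classic `<=` D)
    (D_null : mu (D `\` `[(0 : R), 1[%classic) = 0)
    (F : measurableTypeR R -> R) (mF : measurable_fun D F)
    (B : R) (F_le : forall x, D x -> `|F x| <= B)
    (M : nat) (M_gt0 : (0 < M)%N) (G : nat -> R) (delta : R)
    (F_near : forall j x, (j < M)%N -> j%:R / M%:R <= x < j.+1%:R / M%:R ->
      `|F x - G j| <= delta) :
  `|fine (\int[mu]_(x in D) (F x)%:E)%E - mean M G| <= delta.
Proof.
have m01 : measurable (`[(0 : R), 1[%classic : set (measurableTypeR R)) by [].
have DE : D = `[(0 : R), 1[%classic `|` (D `\` `[(0 : R), 1[%classic).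
  by rewrite setDUK.
have muD : (mu D < +oo)%E.
  rewrite DE measureU//.
  - have : (mu (D `\` `[(0%R : R), 1%R[%classic) < +oo)%E by rewrite D_null ltry.
    apply: lte_add_pinfty.
    have : (mu `[(0%R : R), 1%R[%classic < +oo)%E by rewrite mu_itv// ltry.
    exact.
  - exact: measurableD.
  - by rewrite setIDA setIC -setIDA setDv setI0.
have F_int : mu.-integrable D (EFin \o F).
  apply: measurable_bounded_integrable => //.
  exists B; split; first exact: num_real.
  by move=> y By x Dx /=; rewrite (le_trans (F_le _ Dx))// ltW.
rewrite (negligible_integral (measurableD mD m01))// setDD (setIidr D_sup).
have F01_int : mu.-integrable `[(0 : R), 1[%classic (EFin \o F).
  exact: integrableS F_int.
have := Rintegral_near_step R mu mu_itv F F01_int M G delta F_near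
  M M_gt0 (leqnn M).
by rewrite divff ?mulr1// pnatr_eq0 -lt0n.
Qed.

(** * Replacing the lacunary sum by a sum over digits *)

Lemma periodic_natE (R : realType) (f : R -> R)
    (f_periodic : forall x, f (x + 1) = f x) (n : nat) (x : R) :
  f (x + n%:R) = f x.
Proof.
by elim: n => [|n ih]; rewrite ?addr0// -natr1 addrA f_periodic.
Qed.

(** Let q be the integer such that x lies in the q-th cell of length
    1 / m_(k+1), and q = i b_k + d. Then m_k x - i lies in the d-th cell of
    length 1 / b_k, inside [0, 1): periodicity removes i without crossing a
    possible jump of f at the integers. *)
Lemma near_digit (R : realType) (f : R -> R)
    (f_periodic : forall x, f (x + 1) = f x) (m b : nat -> nat)
    (m_gt0 : forall k, (0 < m k)%N) (b_gt0 : forall k, (0 < b k)%N)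
    (mS : forall k, m k.+1 = (m k * b k)%N)
    (c : nat -> nat -> R) (eta : nat -> R)
    (c_near : forall k d x, (d < b k)%N ->
      d%:R / (b k)%:R <= x < d.+1%:R / (b k)%:R -> `|f x - c k d| <= eta k)
    (n j k : nat) (x : R) : (k < n)%N ->
  j%:R / (m n)%:R <= x < j.+1%:R / (m n)%:R ->
  `|f ((m k)%:R * x) - c k ((j %/ (m n %/ m k.+1)) %% b k)%N| <= eta k.
Proof.
move=> kn /andP[jx xj].
have m_dvd l : (m k.+1 %| m (k.+1 + l))%N.
  by elim: l => [|l ih]; rewrite ?addn0// addnS [X in (_ %| X)%N]mS dvdn_mulr.
have /dvdnP[e mnE] : (m k.+1 %| m n)%N.
  by have := m_dvd (n - k.+1)%N; rewrite subnKC.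
rewrite mnE mulnK//.
have e_gt0 : (0 < e)%N by have := m_gt0 n; rewrite mnE muln_gt0 => /andP[].
set q := (j %/ e)%N; set d := (q %% b k)%N; set i := (q %/ b k)%N.
have qE : q = (i * b k + d)%N := divn_eq q (b k).
have mR l : 0 < (m l)%:R :> R by rewrite ltr0n.
have bR : 0 < (b k)%:R :> R by rewrite ltr0n.
have eR : 0 < e%:R :> R by rewrite ltr0n.
move: jx xj; rewrite ler_pdivrMr// ltr_pdivlMr// mnE natrM => jx xj.
have xq : q%:R <= x * (m k.+1)%:R.
  rewrite -(ler_pM2r eR) -mulrA [_ * e%:R in leRHS]mulrC (le_trans _ jx)//.
  by rewrite -natrM ler_nat leq_trunc_div.
have xq1 : x * (m k.+1)%:R < q.+1%:R.
  rewrite -(ltr_pM2r eR) -mulrA [_ * e%:R in ltLHS]mulrC (lt_le_trans xj)//.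
  by rewrite -natrM ler_nat ltn_ceil.
rewrite -[(m k)%:R * x](subrK i%:R) (periodic_natE R f f_periodic).
apply: c_near; first by rewrite ltn_mod.
rewrite ler_pdivrMr// ltr_pdivlMr//.
move: xq xq1; rewrite mS natrM qE -natr1 natrD natrM -[d.+1%:R]natr1.
set r : R := d%:R; set s : R := i%:R.
by rewrite mulrBl => xq xq1; apply/andP; split; lra.
Qed.

Lemma mean_prod_expi (R : realType) (m b : nat -> nat)
    (m_gt0 : forall k, (0 < m k)%N) (mS : forall k, m k.+1 = (m k * b k)%N)
    (x : nat -> nat -> R) (n : nat) :
  mean (m n) (fun j =>
      expi (\sum_(k < n) x k ((j %/ (m n %/ m k.+1)) %% b k)%N))
  = \prod_(k < n) mean (b k) (fun d => expi (x k d)).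
Proof.
rewrite -(mean_prod_digits _ m b m_gt0 mS (fun k d => expi (x k d))).
by apply: eq_mean => j _; rewrite expi_sum.
Qed.

Lemma lebesgue_measure_itvco (R : realType) (x y : R) : x <= y ->
  lebesgue_measure `[x, y[%classic = (y - x)%:E.
Proof.
rewrite lebesgue_measure_itv/= lte_fin le_eqVlt => /orP[/eqP->|->//].
by rewrite ltxx subrr.
Qed.

Lemma lebesgue01_itv (R : realType) (x y : R) : 0 <= x -> x <= y -> y <= 1 ->
  @lebesgue01 R `[x, y[%classic = (y - x)%:E.
Proof.
move=> x0 xy y1; rewrite /lebesgue01 /mrestr setIidl; last first.
  by apply: subset_itv; rewrite bnd_simp.
exact: lebesgue_measure_itvco.
Qed.

Lemma itvcc_null (R : realType) :
  @lebesgue_measure R (`[(0 : R), 1] `\` `[(0 : R), 1[) = 0.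
Proof.
suff -> : `[(0 : R), 1]%classic `\` `[(0 : R), 1[%classic = [set (1 : R)].
  exact: lebesgue_measure_set1.
apply/seteqP; split => x /=.
  rewrite !in_itv/= => -[/andP[x0 x1] /negP]; rewrite x0/= -leNgt => x1'.
  by apply/le_anti; rewrite x1 x1'.
by move=> ->; rewrite !in_itv/= lexx ler01 ltxx.
Qed.

Lemma lebesgue01_null (R : realType) :
  @lebesgue01 R (setT `\` `[(0 : R), 1[%classic) = 0.
Proof.
by rewrite /lebesgue01 /mrestr setTD setIC -setDE; exact: itvcc_null.
Qed.

(** Cosine and sine are 1-Lipschitz: replacing X by a step function within
    delta changes each integrand by at most |t| delta. *)
Lemma char_fun_near (R : realType) (X : {RV @lebesgue01 R >-> R}) (M : nat)
    (M_gt0 : (0 < M)%N) (T : nat -> R) (delta : R)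
    (X_near : forall j x, (j < M)%N -> j%:R / M%:R <= x < j.+1%:R / M%:R ->
      `|X x - T j| <= delta) (t : R) :
  normc (char_fun X t - mean M (fun j => expi (t * T j))) <= 2 * (`|t| * delta).
Proof.
rewrite mean_complex mulr2n mulrDl mul1r.
apply: le_trans (normc_le_ReIm _ _ _) _.
have near (g : R -> R) : measurable_fun setT g -> (forall x, `|g x| <= 1) ->
    (forall x y, `|g x - g y| <= `|x - y|) ->
    `|fine 'E_(@lebesgue01 R)[fun w => g (t * X w)] - mean M (fun j => g (t * T j))|
      <= `|t| * delta.
  move=> mg g_le g_lip; rewrite unlock.
  apply: (integral_near_step R (@lebesgue01 R) (lebesgue01_itv R) setT _ _
    (lebesgue01_null R) _ _ 1) => //.
    by apply: measurableT_comp => //; exact: measurable_funM.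
  move=> j x jM xj; rewrite (le_trans (g_lip _ _))// -mulrBr normrM.
  by rewrite ler_wpM2l// X_near.
apply: lerD; apply: near.
- exact: continuous_measurable_fun (@continuous_cos R).
- exact: cos_max.
- exact: cos_lipschitz.
- exact: continuous_measurable_fun (@continuous_sin R).
- exact: sin_max.
- exact: sin_lipschitz.
Qed.

Lemma char_fun_lacunary_near (R : realType) (f : {mfun R >-> R})
    (f_periodic : forall x, f (x + 1) = f x) (m : nat -> nat)
    (a : nat -> nat -> R) (b : nat -> nat)
    (m_gt0 : forall k, (0 < m k.+1)%N) (b_gt0 : forall k, (0 < b k)%N)
    (mS : forall k, m k.+2 = (m k.+1 * b k)%N)
    (c : nat -> nat -> R) (eta : nat -> R)
    (c_near : forall k d x, (d < b k)%N ->
      d%:R / (b k)%:R <= x < d.+1%:R / (b k)%:R -> `|f x - c k d| <= eta k)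
    (n : nat) (t : R) :
  normc (char_fun (lacunary_RV f m a n) t
     - \prod_(k < n) mean (b k) (fun d => expi (t * a k.+1 n * c k d)))
  <= 2 * (`|t| * \sum_(k < n) `|a k.+1 n| * eta k).
Proof.
rewrite -(mean_prod_expi R (m \o succn) b m_gt0 mS
  (fun k d => t * a k.+1 n * c k d)).
pose T j := \sum_(k < n) a k.+1 n * c k ((j %/ (m n.+1 %/ m k.+2)) %% b k)%N.
rewrite (eq_mean _ _ _ (fun j => expi (t * T j))); last first.
  by move=> j _; congr expi; rewrite /T mulr_sumr; under eq_bigr do rewrite -mulrA.
apply: char_fun_near => //= j x _ xj.
rewrite /lacunary_sum big_add1 big_mkord /T -sumrB.
rewrite (le_trans (ler_norm_sum _ _ _))// ler_sum// => k _.
rewrite -mulrBr normrM ler_wpM2l//.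
exact: (near_digit R f f_periodic (m \o succn) b m_gt0 b_gt0 mS c eta c_near
  n j k x (ltn_ord k) xj).
Qed.

(** * Sampling a periodic Hoelder function *)

(** Between 0 and 1/2 the bound forces h (1/2)^alpha to be nonnegative. *)
Lemma holder_cst_ge0 (R : realType) (f : R -> R) (h alpha : R)
    (f_holder : forall x y : R, 0 <= x < 1 -> 0 <= y < 1 -> x != y ->
       `|f x - f y| <= h * `|x - y| `^ alpha) : 0 <= h.
Proof.
have /(le_trans (normr_ge0 _)) : `|f 0 - f 2^-1| <= h * `|0 - 2^-1| `^ alpha.
  by apply: f_holder; [lra|lra|rewrite eq_sym invr_neq0].
by rewrite pmulr_lge0// powR_gt0// sub0r normrN normr_gt0 invr_neq0.
Qed.

Lemma holder_bound (R : realType) (f : R -> R) (h alpha : R)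
    (alpha_gt0 : 0 < alpha)
    (f_holder : forall x y : R, 0 <= x < 1 -> 0 <= y < 1 -> x != y ->
       `|f x - f y| <= h * `|x - y| `^ alpha) (x : R) :
  0 <= x < 1 -> `|f x| <= `|f 0| + h.
Proof.
move=> x01; have h_ge0 := holder_cst_ge0 _ _ _ _ f_holder.
have [->|x_neq0] := eqVneq x 0; first by rewrite lerDl.
rewrite -lerBlDl (le_trans (lerB_dist _ _))//.
rewrite (le_trans (f_holder _ _ _ _ _))//; first by rewrite lexx ltr01.
rewrite ler_piMr// subr0 (@le_trans _ _ (1 `^ alpha))//; last by rewrite powR1.
by rewrite ge0_ler_powR ?nnegrE//; [lra|rewrite ger0_norm; lra].
Qed.

Lemma holder_cell (R : realType) (f : R -> R) (h alpha : R)
    (alpha_gt0 : 0 < alpha)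
    (f_holder : forall x y : R, 0 <= x < 1 -> 0 <= y < 1 -> x != y ->
       `|f x - f y| <= h * `|x - y| `^ alpha) (b d : nat) (x : R) :
  (d < b)%N -> d%:R / b%:R <= x < d.+1%:R / b%:R ->
  `|f x - f (d%:R / b%:R)| <= h * (b%:R `^ alpha)^-1.
Proof.
move=> db /andP[dx xd]; have h_ge0 := holder_cst_ge0 _ _ _ _ f_holder.
have b_gt0 : 0 < b%:R :> R by rewrite ltr0n (leq_trans _ db).
have [->|x_neq] := eqVneq x (d%:R / b%:R).
  by rewrite subrr normr0 mulr_ge0// invr_ge0 powR_ge0.
have d0 : 0 <= d%:R / b%:R :> R by rewrite divr_ge0// ltW.
have d1 : d.+1%:R / b%:R <= 1 :> R by rewrite ler_pdivrMr// mul1r ler_nat.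
rewrite (le_trans (f_holder _ _ _ _ _))//; [lra|lra|].
rewrite ler_wpM2l// -(powR_inv1 (powR_ge0 _ _)) powRAC (powR_inv1 (ltW b_gt0)).
rewrite ge0_ler_powR ?nnegrE ?invr_ge0 ?(ltW alpha_gt0) ?(ltW b_gt0)//
  ger0_norm ?subr_ge0//.
by move: xd; rewrite -natr1 mulrDl mul1r; lra.
Qed.

(** Subtracting the mean of the samples makes the discrete variable exactly
    centered, at the cost of doubling the approximation error. *)
Definition centered_sample {R : realType} (f : R -> R) (b d : nat) : R :=
  f (d%:R / b%:R) - mean b (fun i => f (i%:R / b%:R)).

Lemma mean_centered_sample (R : realType) (f : R -> R) (b : nat)
  (b_gt0 : (0 < b)%N) : mean b (centered_sample f b) = 0.
Proof. by rewrite /centered_sample meanB mean_cst// subrr. Qed.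

Lemma integral01_near_mean (R : realType) (F : R -> R)
    (mF : measurable_fun setT F) (F_periodic : F 1 = F 0) (B : R)
    (F_le : forall x, 0 <= x < 1 -> `|F x| <= B) (b : nat) (b_gt0 : (0 < b)%N)
    (delta : R)
    (F_cell : forall d x, (d < b)%N -> d%:R / b%:R <= x < d.+1%:R / b%:R ->
      `|F x - F (d%:R / b%:R)| <= delta) :
  `|fine (\int[lebesgue_measure]_(x in `[0%R, 1%R]) (F x)%:E)%E
    - mean b (fun d => F (d%:R / b%:R))| <= delta.
Proof.
apply: (integral_near_step R (@lebesgue_measure R) _ _ _ _ (itvcc_null R) F _ B)
  => //.
- by move=> x y _ xy _; exact: lebesgue_measure_itvco.
- by apply: subset_itv; rewrite bnd_simp.
- exact: measurable_funTS.
- move=> x /=; rewrite in_itv/= => /andP[x0 x1].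
  have [x_lt1|x_ge1] := ltP x 1; first by rewrite F_le// x0.
  have -> : x = 1 by apply/le_anti; rewrite x1.
  by rewrite F_periodic F_le// lexx ltr01.
Qed.

(** The last two bounds rest on comparing the integrals of f and of f^2 with the
    means of their samples: the mean mu of the samples of f is at most osc in
    absolute value, and the variance of the samples is their mean square minus
    mu^2. *)
Lemma centered_sampleP (R : realType) (f : R -> R) (mf : measurable_fun setT f)
    (f_periodic : f 1 = f 0) (h alpha : R) (alpha_gt0 : 0 < alpha)
    (f_holder : forall x y : R, 0 <= x < 1 -> 0 <= y < 1 -> x != y ->
       `|f x - f y| <= h * `|x - y| `^ alpha)
    (f_mean : (\int[lebesgue_measure]_(x in `[0%R, 1%R]) (f x)%:E = 0)%E)
    (f_var : (\int[lebesgue_measure]_(x in `[0%R, 1%R]) (f x ^+ 2)%:E = 1)%E)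
    (b : nat) (b_gt0 : (0 < b)%N) :
  let B := `|f 0| + h in
  let osc := h * (b%:R `^ alpha)^-1 in
  [/\ forall d, (d < b)%N -> `|centered_sample f b d| <= 2 * B,
      forall d x, (d < b)%N -> d%:R / b%:R <= x < d.+1%:R / b%:R ->
        `|f x - centered_sample f b d| <= 2 * osc
    & `|mean b (fun d => centered_sample f b d ^+ 2) - 1| <= 3 * B * osc].
Proof.
move=> B osc; have cell := holder_cell R f h alpha alpha_gt0 f_holder b.
have f_le := holder_bound R f h alpha alpha_gt0 f_holder.
have bR : 0 < b%:R :> R by rewrite ltr0n.
have unit_cell d (x : R) : (d < b)%N -> d%:R / b%:R <= x < d.+1%:R / b%:R ->
    0 <= x < 1.
  move=> db /andP[dx xd]; rewrite (le_trans _ dx) ?divr_ge0//=.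
  by rewrite (lt_le_trans xd)// ler_pdivrMr// mul1r ler_nat.
have unit_pt d : (d < b)%N -> 0 <= (d%:R / b%:R : R) < 1.
  move=> db; apply: (unit_cell d) => //.
  by rewrite lexx ltr_pM2r ?invr_gt0// ltr_nat/=.
have B_ge0 : 0 <= B by rewrite (le_trans _ (f_le _ (unit_pt _ b_gt0))).
have osc_ge0 : 0 <= osc.
  by rewrite mulr_ge0 ?(holder_cst_ge0 _ _ _ _ f_holder)// invr_ge0 powR_ge0.
set mu := mean b (fun i => f (i%:R / b%:R)).
have mu_le : `|mu| <= osc.
  have := integral01_near_mean R f mf f_periodic B f_le b b_gt0 osc cell.
  by rewrite f_mean/= sub0r normrN.
have mu_leB : `|mu| <= B.
  by apply: normr_mean_bound => // d db; rewrite f_le// unit_pt.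
split.
- move=> d db; rewrite (le_trans (ler_normB _ _))// mulr2n mulrDl mul1r lerD//.
  by rewrite f_le// unit_pt.
- move=> d x db xd; rewrite /centered_sample -/mu opprB addrA addrAC.
  rewrite (le_trans (ler_normD _ _))// mulr2n mulrDl mul1r lerD//.
  exact: cell.
- rewrite (_ : mean b _ =
    mean b (fun d => f (d%:R / b%:R) ^+ 2) - mu ^+ 2); last first.
    transitivity (mean b (fun d => f (d%:R / b%:R) ^+ 2 - 2 * mu * f (d%:R / b%:R)
      + mu ^+ 2)).
      by apply: eq_mean => d _; rewrite /centered_sample -/mu; ring.
    by rewrite meanD meanB meanZ mean_cst// -/mu; ring.
  have f2_le (x : R) : 0 <= x < 1 -> `|f x ^+ 2| <= B ^+ 2.
    by move=> x01; rewrite normrX lerXn2r ?nnegrE// f_le.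
  have f2_cell d (x : R) : (d < b)%N ->
      d%:R / b%:R <= x < d.+1%:R / b%:R ->
      `|f x ^+ 2 - f (d%:R / b%:R) ^+ 2| <= 2 * B * osc.
    move=> db xd; rewrite subr_sqr normrM mulrC.
    apply: ler_pM => //; last exact: cell.
    rewrite (le_trans (ler_normD _ _))// mulr2n mulrDl mul1r lerD//.
      by rewrite f_le// (unit_cell d).
    by rewrite f_le// unit_pt.
  have := integral01_near_mean R (fun x => f x ^+ 2) (measurable_funX 2 mf)
    (congr1 (fun y => y ^+ 2) f_periodic) (B ^+ 2) f2_le b b_gt0 _ f2_cell.
  rewrite f_var/= distrC => h1; rewrite addrAC (le_trans (ler_normB _ _))//.
  have h2 : `|mu ^+ 2| <= B * osc by rewrite normrX expr2 ler_pM.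
  by rewrite (le_trans (lerD h1 h2))//; lra.
Qed.

(** * Bounds on the characteristic function of the lacunary sum *)

(** The factors are compared one by one. Here V is the variance of the
    discrete sum, and Q collects the third order errors. *)
Lemma prod_mean_expi_gauss (R : realType) (b : nat -> nat)
    (b_gt0 : forall k, (0 < b k)%N) (c : nat -> nat -> R) (B : R)
    (c_mean : forall k, mean (b k) (c k) = 0)
    (c_le : forall k d, (d < b k)%N -> `|c k d| <= B)
    (a : nat -> R) (n : nat) (t : R)
    (t_small : forall k, (k < n)%N -> B * (`|t| * `|a k|) <= 1) :
  let V := \sum_(k < n) a k ^+ 2 * mean (b k) (fun d => c k d ^+ 2) in
  let Q := \sum_(k < n) `|a k| ^+ 3 in
  let phi := \prod_(k < n) mean (b k) (fun d => expi (t * a k * c k d)) in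
  normc phi <= expR (- (t ^+ 2 * V / 2) + (B * `|t|) ^+ 3 * Q)
  /\ normc (phi - (expR (- (t ^+ 2 * V / 2)))%:C)
       <= 2 * ((B * `|t|) ^+ 3 * Q).
Proof.
move=> V Q phi.
pose s k := mean (b k) (fun d => c k d ^+ 2).
have s_ge0 k : 0 <= s k.
  rewrite -(mean_cst R _ (b_gt0 k) 0); apply: mean_le => d _; exact: sqr_ge0.
have gauss (k : 'I_n) := normc_mean_expi_gauss R (b k) (b_gt0 k) (c k) B
  (t * a k) (c_mean k) (c_le k).
have {}gauss (k : 'I_n) := gauss k (eq_ind_r (fun z => B * z <= 1)
  (t_small k (ltn_ord k)) (normrM t (a k))).
have VE : - (t ^+ 2 * V / 2) = \sum_(k < n) - (s k * (t * a k) ^+ 2 / 2).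
  rewrite /V mulr_sumr mulr_suml -sumrN; apply: eq_bigr => k _.
  by rewrite -/(s k); ring.
have QE : (B * `|t|) ^+ 3 * Q = \sum_(k < n) (B * `|t * a k|) ^+ 3.
  by rewrite /Q mulr_sumr; apply: eq_bigr => k _; rewrite normrM; ring.
split.
  rewrite VE QE -big_split/= expR_sum /phi normc_prod.
  by apply: ler_prod => k _; rewrite normc_ge0 (gauss k).1.
have -> : (expR (- (t ^+ 2 * V / 2)))%:C =
    \prod_(k < n) (expR (- (s k * (t * a k) ^+ 2 / 2)))%:C.
  by rewrite VE expR_sum rmorph_prod.
rewrite QE mulr_sumr (le_trans (normc_sub_prod _ _ _ _ _ _ _))//.
- by move=> k; exact: normc_mean_expi_le1.
- move=> k; rewrite normc_real ger0_norm ?expR_ge0// -expR0 ler_expR oppr_le0.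
  by rewrite divr_ge0// mulr_ge0// sqr_ge0.
- by apply: ler_sum => k _; exact: (gauss k).2.
Qed.

Lemma expRN_lipschitz (R : realType) (x y : R) : 0 <= x -> 0 <= y ->
  `|expR (- x) - expR (- y)| <= `|x - y|.
Proof.
wlog xy : x y / x <= y => [hw x0 y0|x0 y0].
  have [xy|/ltW yx] := leP x y; first exact: hw.
  by rewrite distrC [`|x - y|]distrC; exact: hw.
rewrite distrC [`|x - y|]distrC distrC !ger0_norm ?subr_ge0 ?ler_expR ?lerN2//.
have -> : - y = - x - (y - x) by ring.
rewrite expRD -[X in X - _]mulr1 -mulrBr.
have h := expR_ge1Dx (- (y - x)).
rewrite (@le_trans _ _ (1 * (y - x)))//; last by rewrite mul1r; lra.
apply: ler_pM; rewrite ?expR_ge0//; last by lra.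
- by rewrite subr_ge0 -expR0 ler_expR; lra.
- by rewrite -expR0 ler_expR; lra.
Qed.

(** The quantitative core of the theorem, at a fixed n, in the rescaled
    variable y = t A. Convergence uses the first bound, whose right-hand side
    involves only the quantities A S and Q, which tend to zero in the theorem;
    uniform integrability uses the second one, where y ranges over an interval
    growing with A. *)
Lemma lacunary_char_fun_bounds (R : realType) (f : {mfun R >-> R})
    (f_periodic : forall x : R, f (x + 1) = f x)
    (h alpha : R) (alpha_gt0 : 0 < alpha)
    (f_holder : forall x y : R, 0 <= x < 1 -> 0 <= y < 1 -> x != y ->
       `|f x - f y| <= h * `|x - y| `^ alpha)
    (f_mean : (\int[lebesgue_measure]_(x in `[0%R, 1%R]) (f x)%:E = 0)%E)
    (f_var : (\int[lebesgue_measure]_(x in `[0%R, 1%R]) (f x ^+ 2)%:E = 1)%E)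
    (m b : nat -> nat) (m_gt0 : forall k, (0 < m k.+1)%N)
    (b_gt0 : forall k, (0 < b k)%N)
    (mS : forall k, m k.+2 = (m k.+1 * b k)%N)
    (a : nat -> nat -> R) (n : nat) :
  let A := array_norm a n in
  let S := \sum_(k < n) `|a k.+1 n| / (b k)%:R `^ alpha in
  let Q := \sum_(k < n) `|a k.+1 n| ^+ 3 in
  let B := `|f 0| + h in
  let phi t := char_fun (lacunary_RV f m a n) t in
  1 <= A -> (forall k, (k < n)%N -> `|a k.+1 n| <= 1) ->
  (forall y, (forall k, (k < n)%N -> 2 * B * (`|y| * `|a k.+1 n|) <= 1) ->
    normc (phi (y / A) - (expR (- y ^+ 2 / 2))%:C) <=
      (4 * h * `|y| + 3 * B * h * y ^+ 2) * (A * S)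
      + 2 * (2 * B * `|y|) ^+ 3 * Q)
  /\
  (forall K y, (forall k, (k < n)%N -> 2 * B * (K * `|a k.+1 n|) <= 1) ->
    Q <= 1 -> 3 * B * h * S <= 2^-1 -> `|y| <= A * K ->
    normc (phi (y / A)) <=
      expR ((2 * B * K) ^+ 3) * expR (- (y ^+ 2 / 4)) + 4 * h * K * S).
Proof.
move=> A S Q B phi A_ge1 a_le1.
pose c k d := centered_sample f (b k) d.
have f10 : f 1 = f 0 by rewrite -[1]add0r f_periodic.
have mf : measurable_fun setT f by [].
have c_spec k := centered_sampleP R f mf f10 h alpha alpha_gt0
  f_holder f_mean f_var (b k) (b_gt0 k).
have h_ge0 : 0 <= h := holder_cst_ge0 _ _ _ _ f_holder.
have B_ge0 : 0 <= B by rewrite addr_ge0.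
have A_gt0 : 0 < A by rewrite (lt_le_trans ltr01).
pose V := \sum_(k < n) a k.+1 n ^+ 2 * mean (b k) (fun d => c k d ^+ 2).
have w_ge0 k : 0 <= ((b k)%:R `^ alpha)^-1 :> R by rewrite invr_ge0 powR_ge0.
have S_ge0 : 0 <= S by apply: sumr_ge0 => k _; rewrite mulr_ge0.
have Q_ge0 : 0 <= Q by apply: sumr_ge0 => k _; rewrite exprn_ge0.
have AE : A ^+ 2 = \sum_(k < n) a k.+1 n ^+ 2.
  rewrite /A /array_norm sqr_sqrtr; last first.
    by rewrite sumr_ge0// => k _; exact: sqr_ge0.
  by rewrite big_add1 big_mkord.
(* As |a_k| <= 1, the weights a_k^2 are at most the |a_k| that occur in S. *)
have V_near : `|V - A ^+ 2| <= 3 * B * h * S.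
  rewrite AE /V -sumrB (le_trans (ler_norm_sum _ _ _))// mulr_sumr ler_sum// => k _.
  rewrite -[X in _ - X]mulr1 -mulrBr normrM.
  have [_ _ hv] := c_spec k.
  rewrite (le_trans (ler_wpM2l _ hv))// -/B ger0_norm ?sqr_ge0//.
  have -> : a k.+1 n ^+ 2 * (3 * B * (h / (b k)%:R `^ alpha)) =
    3 * B * h * (a k.+1 n ^+ 2 / (b k)%:R `^ alpha) by ring.
  rewrite ler_wpM2l ?mulr_ge0// ler_wpM2r// -real_normK ?num_real// expr2.
  by rewrite ler_piMl// a_le1.
have V_ge0 : 0 <= V.
  apply: sumr_ge0 => k _; rewrite mulr_ge0 ?sqr_ge0//.
  rewrite -(mean_cst R _ (b_gt0 k) 0); apply: mean_le => d _; exact: sqr_ge0.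
have phi_near t : normc (phi t -
    \prod_(k < n) mean (b k) (fun d => expi (t * a k.+1 n * c k d)))
    <= 4 * h * `|t| * S.
  have c_near k d x (db : (d < b k)%N)
      (xd : d%:R / (b k)%:R <= x < d.+1%:R / (b k)%:R) :
      `|f x - c k d| <= 2 * (h / (b k)%:R `^ alpha).
    by have [_ + _] := c_spec k; exact.
  rewrite (le_trans (char_fun_lacunary_near R f f_periodic m a b m_gt0 b_gt0 mS c _
    c_near n t))// le_eqVlt; apply/orP; left; apply/eqP.
  rewrite /S !mulr_sumr; apply: eq_bigr => k _; by ring.
have prod_gauss t := prod_mean_expi_gauss R b b_gt0 c (2 * B)
  (fun k => mean_centered_sample R f (b k) (b_gt0 k))
  (fun k => let: And3 c_le _ _ := c_spec k in c_le) (fun k => a k.+1 n) n t.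
have normyA y : `|y / A| = `|y| / A by rewrite normrM normfV (gtr0_norm A_gt0).
have yA_le y : `|y / A| <= `|y|.
  by rewrite normyA ler_pdivrMr// ler_peMr.
split.
- move=> y y_small.
  have [k kn|_] := prod_gauss (y / A).
    rewrite (le_trans _ (y_small k kn))// ler_wpM2l ?mulr_ge0//.
    by rewrite ler_wpM2r.
  rewrite -/V -/Q; set g := \prod_(k < n) _ => g_near.
  set E := expR _ in g_near.
  have -> : phi (y / A) - (expR (- y ^+ 2 / 2))%:C =
      (phi (y / A) - g) + ((g - E%:C) + (E - expR (- y ^+ 2 / 2))%:C).
    by rewrite rmorphB/=; ring.
  rewrite (le_trans (normcD _ _ _))//.
  rewrite (le_trans (lerD (phi_near _) (normcD _ _ _)))//.
  have E_near : normc (E - expR (- y ^+ 2 / 2))%:C <= 3 * B * h * y ^+ 2 * (A * S).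
    rewrite normc_real /E mulNr (le_trans (expRN_lipschitz _ _ _ _ _))//.
    + by rewrite divr_ge0// mulr_ge0// sqr_ge0.
    + by rewrite divr_ge0// sqr_ge0.
    have -> : (y / A) ^+ 2 * V / 2 - y ^+ 2 / 2 =
        (y / A) ^+ 2 / 2 * (V - A ^+ 2) by field; rewrite gt_eqF.
    rewrite normrM ger0_norm ?divr_ge0 ?sqr_ge0//.
    have y2 : (y / A) ^+ 2 <= y ^+ 2.
      rewrite -[leLHS]real_normK ?num_real// -[leRHS]real_normK ?num_real//.
      by rewrite lerXn2r ?nnegrE.
    have y2' : (y / A) ^+ 2 / 2 <= y ^+ 2 by have := sqr_ge0 (y / A); lra.
    rewrite (le_trans (ler_pM _ _ y2' V_near)) ?divr_ge0 ?sqr_ge0//.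
    rewrite mulrA [y ^+ 2 * _]mulrC ler_wpM2l ?ler_peMl//.
    by apply: mulr_ge0; [rewrite !mulr_ge0|exact: sqr_ge0].
  have g1 : 4 * h * `|y / A| * S <= 4 * h * `|y| * (A * S).
    by rewrite ler_pM ?mulr_ge0// ?ler_wpM2l ?mulr_ge0// ler_peMl.
  have g2 : 2 * ((2 * B * `|y / A|) ^+ 3 * Q) <= 2 * (2 * B * `|y|) ^+ 3 * Q.
    rewrite -[leRHS]mulrA ler_wpM2l// ler_wpM2r// lerXn2r ?nnegrE ?mulr_ge0//.
    by rewrite ler_wpM2l ?mulr_ge0.
  rewrite (le_trans (lerD g1 (lerD (le_trans g_near g2) E_near)))//.
  by rewrite le_eqVlt; apply/orP; left; apply/eqP; ring.
- move=> K y y_small Q_le1 S_small y_le.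
  have yA_leK : `|y / A| <= K by rewrite normyA ler_pdivrMr// mulrC.
  have K_ge0 : 0 <= K by rewrite (le_trans _ yA_leK).
  have [k kn|g_le _] := prod_gauss (y / A).
    rewrite (le_trans _ (y_small k kn))// ler_wpM2l ?mulr_ge0//.
    by rewrite ler_wpM2r.
  move: g_le; rewrite -/V -/Q; set g := \prod_(k < n) _ => g_le.
  have -> : phi (y / A) = g + (phi (y / A) - g) by ring.
  rewrite (le_trans (normcD _ _ _))// lerD//; last first.
    rewrite (le_trans (phi_near _))// ler_wpM2r// ler_wpM2l// mulr_ge0//.
  rewrite (le_trans g_le)// -expRD ler_expR addrC lerD//.
    rewrite (@le_trans _ _ ((2 * B * K) ^+ 3 * 1))//; last by rewrite mulr1.
    rewrite ler_pM ?exprn_ge0 ?mulr_ge0// lerXn2r ?nnegrE ?mulr_ge0//.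
    by rewrite ler_wpM2l ?mulr_ge0.
  rewrite lerN2.
  (* The loss of a factor 2 in the exponent absorbs the error on V. *)
  have V_large : A ^+ 2 / 2 <= V.
    have A2 : 1 <= A ^+ 2 by rewrite expr_ge1// ltW.
    move: (le_trans V_near S_small); rewrite ler_norml => /andP[]; lra.
  have -> : y ^+ 2 / 4 = (y / A) ^+ 2 * (A ^+ 2 / 2) / 2 by field; rewrite gt_eqF.
  by rewrite ler_wpM2r// ler_wpM2l// sqr_ge0.
Qed.

(** * Uniform integrability from Gaussian domination *)

(** The integral of a nonnegative function is a supremum over the simple
    functions below it, so that domination alone gives the inequality; this
    spares a proof that characteristic functions are measurable. *)
Lemma ge0_le_integral_dom d (T : measurableType d) (R : realType)
    (mu : {measure set T -> \bar R}) (D : set T) (f g : T -> \bar R)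
    (f_ge0 : forall x, (0 <= f x)%E) (g_ge0 : forall x, (0 <= g x)%E)
    (le_fg : forall x, D x -> (f x <= g x)%E) :
  (\int[mu]_(x in D) f x <= \int[mu]_x g x)%E.
Proof.
rewrite integral_mkcond.
have fD_ge0 x : (0 <= (f \_ D) x)%E by rewrite patchE; case: ifP.
rewrite !ge0_integralTE//; apply: ereal_sup_le => _ [s sf <-]; exists s => // x.
rewrite (le_trans (sf x))// patchE; case: ifPn => // /set_mem; exact: le_fg.
Qed.

(** With z = y^2 / 8, exp(- z) <= 1 / z: half of the Gaussian exponent is
    traded for a factor that vanishes as c grows. *)
Lemma gauss_tail (R : realType) (c y : R) : 0 < c -> c <= `|y| ->
  expR (- (y ^+ 2 / 4)) <= 8 / c ^+ 2 * expR (- (y ^+ 2 / 8)).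
Proof.
move=> c_gt0 cy; set z := y ^+ 2 / 8.
have y2_gt0 : 0 < y ^+ 2.
  by rewrite exprn_even_gt0//= -normr_gt0 (lt_le_trans c_gt0).
have z_gt0 : 0 < z by rewrite divr_gt0.
have -> : - (y ^+ 2 / 4) = - z + - z by rewrite /z; field.
rewrite expRD ler_wpM2r ?expR_ge0//.
have z_le : z <= expR z by rewrite (le_trans _ (expR_ge1Dx z))// lerDr.
rewrite expRN (@le_trans _ _ z^-1)//.
  by rewrite lef_pV2 ?posrE ?expR_gt0.
rewrite /z invf_div ler_pM2l// lef_pV2 ?posrE ?(exprn_gt0 2 c_gt0)//.
by rewrite -[leRHS]real_normK ?num_real// lerXn2r ?nnegrE// ltW.
Qed.

(** The integrand is proportional to the density of the centered normal law
    of standard deviation 2; only the finiteness of the integral matters. *)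
Lemma integral_gauss8 (R : realType) : exists2 kappa : R, 0 <= kappa &
  (\int[lebesgue_measure]_y (expR (- (y ^+ 2 / 8)))%:E = kappa%:E)%E.
Proof.
have two_neq0 : (2 : R) != 0 by rewrite pnatr_eq0.
have peak := normal_peak_gt0 two_neq0.
exists (normal_peak (2 : R))^-1; first by rewrite invr_ge0 ltW.
under eq_integral => y _.
  rewrite (_ : expR _ = (normal_peak (2 : R))^-1 * normal_pdf 0 2 y); last first.
    rewrite normal_pdfE// mulKf ?gt_eqF// /normal_fun subr0 mulNr.
    by congr (expR (- (_ / _))); ring.
  rewrite EFinM; over.
rewrite ge0_integralZl_EFin//.
- by rewrite integral_normal_pdf mule1.
- by move=> y _; rewrite lee_fin normal_pdf_ge0.
- by apply/measurable_EFinP; exact: measurable_normal_pdf.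
- by rewrite invr_ge0 ltW.
Qed.

Lemma integral_normc_tail (R : realType) (g : R -> R[i]) (C w L c kappa : R)
    (C_ge0 : 0 <= C) (w_ge0 : 0 <= w) (L_ge0 : 0 <= L) (c_gt0 : 0 < c)
    (kappaE : (\int[lebesgue_measure]_y (expR (- (y ^+ 2 / 8)))%:E = kappa%:E)%E)
    (g_le : forall y, normc (g y) <=
      C * expR (- (y ^+ 2 / 4)) + w * \1_`[- L, L]%classic y) :
  (\int[lebesgue_measure]_(x in [set y : R | (c <= `|y|)%R]) (normc (g x))%:E
    <= (8 * C * kappa / c ^+ 2 + 2 * w * L)%:E)%E.
Proof.
have D_ge0 : 0 <= C * (8 / c ^+ 2) by rewrite mulr_ge0 ?divr_ge0 ?exprn_ge0// ltW.
have me : measurable_fun setT (fun y : R => expR (- (y ^+ 2 / 8))).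
  apply: measurableT_comp => //; apply: measurableT_comp => //.
  by apply: measurable_funM => //; exact: measurable_funX.
have muL : lebesgue_measure `[- L, L]%classic = (2 * L)%:E.
  rewrite lebesgue_measure_itv/= lte_fin; case: ltP => LL.
    by rewrite -EFinB; congr (_%:E); ring.
  have -> : L = 0 by lra.
  by rewrite mulr0.
have mI : measurable (`[- L, L]%classic : set (measurableTypeR R)) by [].
have intI : (\int[lebesgue_measure]_y (\1_`[(- L)%R, L]%classic y)%:E
    = (2 * L)%:E)%E by rewrite integral_indic// setIT; exact: muL.
apply: (@le_trans _ _ (\int[lebesgue_measure]_y
  ((C * (8 / c ^+ 2))%:E * (expR (- (y ^+ 2 / 8)))%:E
   + w%:E * (\1_`[(- L)%R, L]%classic y)%:E))%E).
  apply: ge0_le_integral_dom => y.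
  - by rewrite lee_fin normc_ge0.
  - by rewrite adde_ge0// mule_ge0// lee_fin ?expR_ge0.
  - move=> /= cy; rewrite -!EFinM -EFinD lee_fin (le_trans (g_le y))// lerD2r.
    by rewrite -[leRHS]mulrA ler_wpM2l// gauss_tail.
have mI' : measurable_fun [set: measurableTypeR R]
    (fun y : measurableTypeR R => (\1_`[(- L)%R, L]%classic y : R)%:E).
  by apply: measurableT_comp => //; exact: measurable_indic.
have me' : measurable_fun [set: measurableTypeR R]
    (fun y : measurableTypeR R => (expR (- (y ^+ 2 / 8)))%:E).
  by apply: measurableT_comp => //; exact: me.
rewrite ge0_integralD//; first last.
- exact: (measurable_funeM w%:E mI').
- by move=> y _; rewrite mule_ge0// lee_fin.
- exact: (measurable_funeM _ me').
- by move=> y _; rewrite mule_ge0// lee_fin expR_ge0.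
rewrite (ge0_integralZl_EFin _ _ _ mI')//.
rewrite (ge0_integralZl_EFin _ _ _ me')//.
rewrite kappaE intI -!EFinM -EFinD lee_fin.
by rewrite le_eqVlt; apply/orP; left; apply/eqP; ring.
Qed.

Lemma ereal_sup_cvg0 (R : realType) (J : nat -> R -> \bar R)
    (J_ge0 : forall n c, (0 <= J n c)%E)
    (J_small : forall e : R, 0 < e ->
      exists c0 : R, forall n c, c0 < c -> (J n c <= e%:E)%E) :
  (fun c : R => ereal_sup [set J n c | n in [set: nat]]) @ +oo --> 0%E.
Proof.
have sup_ge0 c : (0 <= ereal_sup [set J n c | n in [set: nat]])%E.
  by rewrite (le_trans (J_ge0 0%N c))//; apply: ereal_sup_ubound; exists 0%N.
have sup_le e c0 c : (forall n c, c0 < c -> (J n c <= e%:E)%E) -> c0 < c ->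
    (ereal_sup [set J n c | n in [set: nat]] <= e%:E)%E.
  by move=> J_le c0c; apply: ge_ereal_sup => _ [n _ <-]; exact: J_le.
apply/fine_cvgP; split.
  have [c0 J_le] := J_small 1 ltr01.
  near=> c; have c0c : c0 < c by near: c; exact: (nbhs_pinfty_gt (num_real c0)).
  by rewrite ge0_fin_numE// (le_lt_trans (sup_le _ _ c J_le c0c)) ?ltry.
apply/cvgrPdist_le => e e_gt0; have [c0 J_le] := J_small e e_gt0.
near=> c; have c0c : c0 < c by near: c; exact: (nbhs_pinfty_gt (num_real c0)).
have s_le := sup_le _ _ c J_le c0c.
rewrite /= sub0r normrN ger0_norm ?fine_ge0// -lee_fin fineK//.
by rewrite ge0_fin_numE// (le_lt_trans s_le) ?ltry.
Unshelve. all: by end_near. Qed.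

(** The Gaussian part has uniformly small tails, and the other part has total
    mass 2 w_n L_n, which is small for n large. The finitely many remaining
    functions vanish outside bounded intervals, hence on {|y| >= c} for c large. *)
Lemma bounded_unif_integrable_gauss (R : realType) (g : nat -> R -> R[i])
    (C : R) (L w : nat -> R) (C_ge0 : 0 <= C) (L_ge0 : forall n, 0 <= L n)
    (w_ge0 : forall n, 0 <= w n)
    (g_supp : forall n y, L n < `|y| -> g n y = 0)
    (g_le : \forall n \near \oo, forall y, `|y| <= L n ->
      normc (g n y) <= C * expR (- (y ^+ 2 / 4)) + w n)
    (wL_cvg0 : w n * L n @[n --> \oo] --> (0 : R)) :
  bounded_unif_integrable g.
Proof.
have [kappa kappa_ge0 kappaE] := integral_gauss8 R.
apply: ereal_sup_cvg0 => [n c|e e_gt0].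
  by apply: integral_ge0 => y _; rewrite lee_fin normc_ge0.
have e4 : 0 < e / 4 by rewrite divr_gt0.
have wL_small : \forall n \near \oo, w n * L n <= e / 4.
  move/cvgrPdist_le: wL_cvg0 => /(_ _ e4); apply: filterS => n.
  by rewrite sub0r normrN; exact: le_trans (ler_norm _).
have [N _ N_large] : \forall n \near \oo, (w n * L n <= e / 4) /\
    forall y, `|y| <= L n -> normc (g n y) <= C * expR (- (y ^+ 2 / 4)) + w n.
  by apply: filterS2 wL_small g_le.
(* For c > 1 + q, the Gaussian tail 8 C kappa / c^2 is at most e / 2. *)
pose q := 8 * C * kappa * 2 / e.
have q_ge0 : 0 <= q by rewrite divr_ge0 ?mulr_ge0// ltW.
have sum_ge0 : 0 <= \sum_(n < N) L n by rewrite sumr_ge0.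
exists (1 + q + \sum_(n < N) L n) => n c c_large.
have c_gt0 : 0 < c by lra.
have [nN|Nn] := ltnP n N.
  rewrite integral0_eq ?lee_fin ?ltW// => y /= cy.
  rewrite g_supp ?normc0//; apply: lt_le_trans cy.
  have : L n <= \sum_(n < N) L n.
    by rewrite (bigD1 (Ordinal nN))//= lerDl sumr_ge0.
  by lra.
have [wL {}g_le] := N_large n Nn.
have := integral_normc_tail R (g n) C (w n) (L n) c kappa C_ge0 (w_ge0 n)
  (L_ge0 n) c_gt0 kappaE.
move=> /(_ _)/le_trans; apply.
  move=> y; rewrite indicE; have [yL|yL] := boolP (y \in _).
    rewrite mulr1; apply: g_le; move: yL; rewrite inE/= in_itv/=.
    by rewrite -ler_norml.
  rewrite mulr0 addr0 g_supp ?normc0 ?mulr_ge0 ?expR_ge0//.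
  move: yL; rewrite notin_setE/= in_itv/= => /negP.
  by rewrite -ler_norml -ltNge.
rewrite lee_fin.
have : 8 * C * kappa / c ^+ 2 <= e / 2.
  rewrite ler_pdivrMr ?exprn_gt0//.
  have -> : 8 * C * kappa = e / 2 * q by rewrite /q; field; rewrite gt_eqF.
  rewrite ler_wpM2l ?divr_ge0 ?(ltW e_gt0)//.
  by rewrite (@le_trans _ _ c)//; [lra|rewrite expr2 ler_peMr; lra].
by rewrite -mulrA; lra.
Qed.

Lemma cvg_complex_dist (R : realType) (u : nat -> R[i]) (l : R[i]) (v : nat -> R)
    (uv : \forall n \near \oo, normc (u n - l) <= v n)
    (v_cvg0 : v n @[n --> \oo] --> (0 : R)) :
  u n @[n --> \oo] --> l.
Proof.
apply/cvgrPdist_le => /= e; rewrite ltcE => /= /andP[/eqP e_im e_gt0].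
move/cvgrPdist_le: v_cvg0 => /(_ _ e_gt0).
apply: filterS2 uv => n un; rewrite sub0r normrN => vn.
rewrite lecE/= e_im eqxx/= -/(normc (l - u n)) normcBC (le_trans un)//.
by rewrite (le_trans (ler_norm _)).
Qed.

(** * Passage to the limit *)

Lemma near_array_entries_le (R : realType) (a : nat -> nat -> R)
    (a_cube : \sum_(k < n) `|a k.+1 n| ^+ 3 @[n --> \oo] --> (0 : R))
    (e : R) (e_gt0 : 0 < e) :
  \forall n \near \oo, forall k, (k < n)%N -> `|a k.+1 n| <= e.
Proof.
have e3_gt0 : 0 < e ^+ 3 by rewrite exprn_gt0.
move/cvgrPdist_le: a_cube => /(_ _ e3_gt0); apply: filterS => n.
rewrite sub0r normrN => /(le_trans (ler_norm _)) sum_le k kn.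
rewrite -(ler_pXn2r (ltn0Sn 2)) ?nnegrE ?(ltW e_gt0)// (le_trans _ sum_le)//.
by rewrite (bigD1 (Ordinal kn))//= lerDl sumr_ge0// => i _; rewrite exprn_ge0.
Qed.

Local Close Scope complex_scope.

Theorem theorem2p15 (R : realType)
  (f : {mfun R >-> R})
  (f_periodic : forall x : R, f (x + 1) = f x)
  (h alpha : R) (alpha_gt0 : 0 < alpha)
  (f_holder : forall x y : R, 0 <= x < 1 -> 0 <= y < 1 -> x != y ->
     `|f x - f y| <= h * `|x - y| `^ alpha)
  (f_mean : (\int[lebesgue_measure]_(x in `[0%R, 1%R]) (f x)%:E = 0)%E)
  (f_var : (\int[lebesgue_measure]_(x in `[0%R, 1%R]) (f x ^+ 2)%:E = 1)%E)
  (m : nat -> nat)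
  (m_gt0 : forall k, (1 <= k)%N -> (0 < m k)%N)
  (m_incr : forall k, (1 <= k)%N -> (m k < m k.+1)%N)
  (m_dvd : forall k, (1 <= k)%N -> (m k %| m k.+1)%N)
  (b_ge2 : forall k, (1 <= k)%N -> (2 <= gap_ratio m k)%N)
  (b_infty : gap_ratio m k @[k --> \oo] --> \oo)
  (a : nat -> nat -> R)
  (A_infty : array_norm a n @[n --> \oo] --> +oo)
  (a_cube : \sum_(1 <= k < n.+1) `|a k n| ^+ 3 @[n --> \oo] --> (0 : R))
  (a_ratio : array_norm a n *
       (\sum_(1 <= k < n.+1) `|a k n| / (gap_ratio m k)%:R `^ alpha)
     @[n --> \oo] --> (0 : R)) :
  mod_gaussian_weak (lacunary_RV f m a) (array_norm a).
Proof.
pose b k := gap_ratio m k.+1.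
have b_gt0 k : (0 < b k)%N by rewrite (leq_trans _ (b_ge2 k.+1 _)).
have mS k : m k.+2 = (m k.+1 * b k)%N by rewrite mulnC divnK// m_dvd.
pose A n := array_norm a n.
pose S n := \sum_(k < n) `|a k.+1 n| / (b k)%:R `^ alpha.
pose Q n := \sum_(k < n) `|a k.+1 n| ^+ 3.
pose B := `|f 0| + h.
have h_ge0 : 0 <= h := holder_cst_ge0 _ _ _ _ f_holder.
have B_ge0 : 0 <= B by rewrite addr_ge0.
have A_ge0 n : 0 <= A n by exact: sqrtr_ge0.
have S_ge0 n : 0 <= S n.
  by apply: sumr_ge0 => k _; rewrite mulr_ge0// invr_ge0 powR_ge0.
have Q_cvg0 : Q n @[n --> \oo] --> (0 : R).
  have <- : (fun n => \sum_(1 <= k < n.+1) `|a k n| ^+ 3) = Q.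
    by apply/funext => n; rewrite big_add1 big_mkord.
  exact: a_cube.
have AS_cvg0 : A n * S n @[n --> \oo] --> (0 : R).
  have SE n : \sum_(1 <= k < n.+1) `|a k n| / (gap_ratio m k)%:R `^ alpha = S n.
    by rewrite big_add1 big_mkord.
  by under eq_cvg do rewrite -SE.
have A_large : \forall n \near \oo, 1 <= A n.
  by move/cvgryPge: A_infty; exact.
have a_small K : 0 <= K ->
    \forall n \near \oo, forall k, (k < n)%N -> 2 * B * (K * `|a k.+1 n|) <= 1.
  move=> K_ge0; have BK_ge0 : 0 <= 2 * B * K by rewrite !mulr_ge0.
  (* Adding 1 keeps the threshold positive even if B K = 0. *)
  have e_gt0 : 0 < (1 + 2 * B * K)^-1 by rewrite invr_gt0; lra.
  apply: filterS (near_array_entries_le R a Q_cvg0 _ e_gt0) => n a_le k kn.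
  rewrite mulrA (le_trans (ler_wpM2l BK_ge0 (a_le k kn)))//.
  by rewrite ler_pdivrMr; lra.
have a_le1 := near_array_entries_le R a Q_cvg0 1 ltr01.
have bounds n := lacunary_char_fun_bounds R f f_periodic h alpha alpha_gt0
  f_holder f_mean f_var m b (fun k => m_gt0 k.+1 isT) b_gt0 mS a n.
split => //.
- move=> t; apply: (cvg_complex_dist _ _ _ (fun n =>
    (4 * h * `|t| + 3 * B * h * t ^+ 2) * (A n * S n)
      + 2 * (2 * B * `|t|) ^+ 3 * Q n)).
    near=> n; have [] := bounds n.
    + by near: n.
    + by near: n.
    + move=> + _; apply; near: n; exact: a_small.
  rewrite -[X in _ --> X]addr0.
  rewrite -[in X in _ --> X + _](mulr0 (4 * h * `|t| + 3 * B * h * t ^+ 2)).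
  rewrite -[X in _ --> _ + X](mulr0 (2 * (2 * B * `|t|) ^+ 3)).
  by apply: cvgD; apply: cvgMr.
- move=> K K_ge0.
  apply: (bounded_unif_integrable_gauss R _ (expR ((2 * B * K) ^+ 3))
    (fun n => A n * K) (fun n => 4 * h * K * S n)).
  + exact: expR_ge0.
  + by move=> n; rewrite mulr_ge0.
  + by move=> n; rewrite !mulr_ge0.
  + by move=> n y y_gt; rewrite indicE memNset ?mulr0//= leNgt y_gt.
  + have Q_le1 : \forall n \near \oo, Q n <= 1.
      move/cvgrPdist_le: Q_cvg0 => /(_ _ ltr01); apply: filterS => n.
      by rewrite sub0r normrN; exact: le_trans (ler_norm _).
    have S_small : \forall n \near \oo, 3 * B * h * S n <= 2^-1.
      have e_gt0 : 0 < (2 * (1 + 3 * B * h))^-1.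
        by rewrite invr_gt0 mulr_gt0// ltr_pwDl// !mulr_ge0.
      move/cvgrPdist_le: AS_cvg0 => /(_ _ e_gt0).
      apply: filterS2 A_large => n A_ge1; rewrite sub0r normrN.
      move=> /(le_trans (ler_norm _)) AS_le.
      have S_le : S n <= (2 * (1 + 3 * B * h))^-1.
        by rewrite (le_trans _ AS_le)// ler_peMl.
      have Bh_ge0 : 0 <= 3 * B * h by rewrite !mulr_ge0.
      rewrite (le_trans (ler_wpM2l Bh_ge0 S_le))// invfM mulrCA ler_piMr//.
      by rewrite ler_pdivrMr; lra.
    near=> n; move=> y y_le.
    rewrite [X in char_fun _ _ * X](_ : _ = 1) ?mulr1; last first.
      by rewrite indicE mem_set.
    have [] := bounds n; [by near: n|by near: n|move=> _; apply => //].
    * by near: n; exact: a_small.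
    * by near: n.
    * by near: n.
  + have -> : (fun n => 4 * h * K * S n * (A n * K)) =
        (fun n => 4 * h * K * K * (A n * S n)) by apply/funext => n; ring.
    rewrite -[X in _ --> X](mulr0 (4 * h * K * K)).
    exact: cvgMr.
Unshelve. all: by end_near. Qed.
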